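(* Let $\Omega\subset\mathbb{R}^d$ be bounded and measurable with $|\Omega|>0$, and let $V\subset\Omega$ be measurable with $|V|>0$. For every $N\in\mathbb{N}$ there exists a constant $\gamma_{\Omega,V,N}>0$ such that $$\|p\|_{L^2(V)}^2\ \geq\ \gamma_{\Omega,V,N}\,\|p\|_{L^2(\Omega)}^2$$ for every exponential polynomial $$p(x)=\sum_{j=1}^{M}a_je^{i\xi_j\cdot x},\qquad M\leq N,$$ with $a_j\in\mathbb{C}$ and $\xi_j\in\mathbb{R}^d$ arbitrary. In particular, $\gamma_{\Omega,V,N}$ is independent of the magnitudes, mutual separations, and spectral variation of the frequencies $\xi_j$.
   Context: $|\cdot|$ denotes Lebesgue measure on $\mathbb{R}^d$. *)

(* Defs.v *)
From HB Require Import structures.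
From mathcomp Require Import all_boot all_order all_algebra.
From mathcomp Require Import complex.
From mathcomp Require Import all_classical all_reals all_analysis.

Set Implicit Arguments.
Unset Strict Implicit.
Unset Printing Implicit Defensive.

Import Order.TTheory GRing.Theory Num.Theory.
Import numFieldNormedType.Exports.

Local Open Scope classical_set_scope.
Local Open Scope ring_scope.

Fact rV_display : measure_display.
Proof. exact: default_measure_display. Qed.

(* 'rV[R]_d carries its Borel sigma-algebra, generated by the coordinate maps. *)
Section measurable_rV.
Context {R : realType} {d : nat}.

Let coord : 'I_d -> 'rV[R]_d -> measurableTypeR R := fun i x => x ord0 i.

Let rV_set0 : g_sigma_preimage coord set0.
Proof. exact: sigma_algebra0. Qed.

Let rV_setC A : g_sigma_preimage coord A -> g_sigma_preimage coord (~` A).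
Proof. exact: sigma_algebraC. Qed.

Let rV_bigcup (F : (set 'rV[R]_d)^nat) :
  (forall i, g_sigma_preimage coord (F i)) ->
  g_sigma_preimage coord (\bigcup_i (F i)).
Proof. exact: sigma_algebra_bigcup. Qed.

HB.instance Definition _ := @isMeasurable.Build rV_display
  'rV[R]_d (g_sigma_preimage coord) rV_set0 rV_setC rV_bigcup.

Lemma measurable_coord_rV (i : 'I_d) :
  measurable_fun [set: 'rV[R]_d] (fun x => x ord0 i : measurableTypeR R).
Proof.
move=> _ Y mY; rewrite setTI; apply: sub_sigma_algebra => /=.
rewrite -bigcup_seq/=; exists i => /=; first by rewrite mem_index_enum.
by exists Y => //; rewrite setTI.
Qed.

Lemma measurable_fun_rV d' (T : measurableType d') (f : T -> 'rV[R]_d) :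
  (forall i, measurable_fun [set: T] (fun t => f t ord0 i : measurableTypeR R)) ->
  measurable_fun [set: T] f.
Proof.
move=> mf; apply: measurability; first reflexivity.
move=> _ [B + <-]; rewrite -bigcup_seq/= => -[i _ [C mC <-]].
by rewrite setTI; exact: mf.
Qed.

End measurable_rV.

Section lebesgue_rV.
Context {R : realType}.
Local Open Scope ereal_scope.

Definition cons_rV (d : nat) (p : measurableTypeR R * 'rV[R]_d) : 'rV[R]_d.+1 :=
  row_mx (const_mx p.1 : 'rV[R]_1) p.2.

Lemma measurable_cons_rV d : measurable_fun setT (@cons_rV d).
Proof.
apply: measurable_fun_rV => i; have := splitP (i : 'I_(1 + d)) => -[] j ij.
- have -> : i = lshift d j :> 'I_(1 + d) by exact/val_inj.
  under eq_fun do rewrite (row_mxEl (const_mx _ : 'rV[R]_1)) mxE.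
  exact: measurable_fst.
- have -> : i = rshift 1 j :> 'I_(1 + d) by exact/val_inj.
  under eq_fun do rewrite (row_mxEr (const_mx _ : 'rV[R]_1)).
  exact: (measurableT_comp (measurable_coord_rV j) measurable_snd).
Qed.

Definition uncons_rV (d : nat) (x : 'rV[R]_d.+1) :
    measurableTypeR R * 'rV[R]_d :=
  (x ord0 ord0, \row_(i < d) x ord0 (lift ord0 i)).

Lemma cons_rVK d : cancel (@cons_rV d) (@uncons_rV d).
Proof.
move=> [a u]; congr pair => /=.
- have -> : ord0 = lshift d ord0 :> 'I_(1 + d) by exact/val_inj.
  by rewrite (row_mxEl (const_mx a : 'rV[R]_1)) mxE.
- apply/rowP => i; rewrite mxE.
  have -> : lift ord0 i = rshift 1 i :> 'I_(1 + d) by exact/val_inj.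
  by rewrite (row_mxEr (const_mx a : 'rV[R]_1)).
Qed.

Lemma measurable_uncons_rV d : measurable_fun setT (@uncons_rV d).
Proof.
apply/measurable_fun_pairP; split; first exact: measurable_coord_rV.
apply: measurable_fun_rV => i; rewrite /uncons_rV/=.
by under eq_fun do rewrite mxE; exact: measurable_coord_rV.
Qed.

(* The image of (Lebesgue measure on R) \x mu under R * R^d ~ R^(d+1). *)
Section lebesgue_rVS.
Context {d : nat} (mu : {sigma_finite_measure set 'rV[R]_d -> \bar R}).

Definition lebesgue_rVS : set 'rV[R]_d.+1 -> \bar R :=
  pushforward (lebesgue_measure \x mu) (@cons_rV d).

Let lebesgue_rVS0 : lebesgue_rVS set0 = 0.
Proof. by rewrite /lebesgue_rVS /pushforward preimage_set0 measure0. Qed.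

Let lebesgue_rVS_ge0 A : 0 <= lebesgue_rVS A.
Proof. by rewrite /lebesgue_rVS /pushforward; exact: measure_ge0. Qed.

Let lebesgue_rVS_sigma_additive : semi_sigma_additive lebesgue_rVS.
Proof.
move=> F mF tF mUF; rewrite /lebesgue_rVS /pushforward preimage_bigcup.
have mp A : measurable A -> measurable (@cons_rV d @^-1` A).
  by move=> mA; rewrite -[X in measurable X]setTI; exact: measurable_cons_rV.
apply: measure_semi_sigma_additive.
- by move=> n; exact: mp.
- apply/trivIsetP => /= i j _ _ ij; rewrite -preimage_setI.
  by move/trivIsetP : tF => /(_ _ _ _ _ ij) ->//; rewrite preimage_set0.
- by rewrite -preimage_bigcup; exact: mp.
Qed.

HB.instance Definition _ := isMeasure.Build _ _ _ lebesgue_rVS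
  lebesgue_rVS0 lebesgue_rVS_ge0 lebesgue_rVS_sigma_additive.

Let lebesgue_rVS_sigma_finite : sigma_finite setT lebesgue_rVS.
Proof.
have /sigma_finiteP[F [TF ndF Foo]] := sigma_finiteT (@lebesgue_measure R).
have /sigma_finiteP[G [TG ndG Goo]] := sigma_finiteT mu.
exists (fun n => @uncons_rV d @^-1` (F n `*` G n)).
  rewrite -preimage_bigcup; apply/esym/seteqP; split => // x _.
  have [k _ Fk] : (\bigcup_k F k) (uncons_rV x).1 by rewrite -TF.
  have [l _ Gl] : (\bigcup_k G k) (uncons_rV x).2 by rewrite -TG.
  exists (maxn k l) => //; split.
  - by move: Fk; exact/subsetPset/ndF/leq_maxl.
  - by move: Gl; exact/subsetPset/ndG/leq_maxr.
move=> n; have [mF Fn] := Foo n; have [mG Gn] := Goo n; split.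
  rewrite -[X in measurable X]setTI; apply: measurable_uncons_rV => //.
  exact: measurableX.
rewrite /lebesgue_rVS /pushforward -comp_preimage.
have -> : @uncons_rV d \o @cons_rV d = id by apply/funext => p /=; exact: cons_rVK.
by rewrite preimage_id product_measure1E// lte_mul_pinfty// ge0_fin_numE.
Qed.

HB.instance Definition _ := Measure_isSigmaFinite.Build _ _ _ lebesgue_rVS
  lebesgue_rVS_sigma_finite.

End lebesgue_rVS.

(* The Borel-Lebesgue measure on R^d, as the d-fold product of the Lebesgue
   measure on R (R^0 being a single point of mass 1). *)
Fixpoint borel_lebesgue_rV (d : nat) :
    {sigma_finite_measure set 'rV[R]_d -> \bar R} :=
  match d with
  | 0 => \d_(0%R : 'rV[R]_0)
  | d'.+1 => lebesgue_rVS (borel_lebesgue_rV d')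
  end.

(* Its completion. *)
Definition lebesgue_rV (d : nat) :=
  @completed_measure_extension _ _ _ (borel_lebesgue_rV d).

HB.instance Definition _ d := Measure.on (@lebesgue_rV d).

Local Close Scope ereal_scope.

Lemma measurable_box (d : nat) (a b : 'rV[R]_d) :
  measurable [set x : 'rV[R]_d | forall i, a ord0 i <= x ord0 i <= b ord0 i].
Proof.
rewrite [X in measurable X](_ : _ = \big[setI/setT]_(i < d)
  ((fun x : 'rV[R]_d => x ord0 i) @^-1` `[a ord0 i, b ord0 i])); last first.
  rewrite -bigcap_seq; apply/seteqP; split => x /= H i.
    by move=> _ /=; rewrite in_itv/=; exact: H.
  by have := H i; rewrite /= mem_index_enum in_itv/=; apply.
apply: bigsetI_measurable => i _.
by rewrite -[X in measurable X]setTI; exact: measurable_coord_rV.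
Qed.
Lemma lebesgue_rV_box (d : nat) (a b : 'rV[R]_d) :
  (forall i, a ord0 i <= b ord0 i) ->
  lebesgue_rV [set x : 'rV[R]_d | forall i, a ord0 i <= x ord0 i <= b ord0 i] =
    (\prod_(i < d) (b ord0 i - a ord0 i))%:E.
Proof.
move=> ab; rewrite /lebesgue_rV /completed_measure_extension.
rewrite measurable_mu_extE; last exact: measurable_box.
elim: d => [|d IH] in a b ab *.
  by rewrite big_ord0 /= diracE mem_set//= => -[].
rewrite big_ord_recl /=.
rewrite /lebesgue_rVS /pushforward.
set A := `[a ord0 ord0, b ord0 ord0]%classic : set (measurableTypeR R).
pose a' := \row_(i < d) a ord0 (lift ord0 i).
pose b' := \row_(i < d) b ord0 (lift ord0 i).
rewrite [X in product_measure1 _ _ X](_ : _ = A `*`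
   [set x : 'rV[R]_d | forall i, a' ord0 i <= x ord0 i <= b' ord0 i]); last first.
  have E (x : measurableTypeR R * 'rV[R]_d) (i : 'I_d) : (cons_rV x) ord0 (lift ord0 i) = x.2 ord0 i.
    by rewrite -[in RHS](cons_rVK x) /= mxE.
  have E0 (x : measurableTypeR R * 'rV[R]_d) : (cons_rV x) ord0 ord0 = x.1.
    exact: (congr1 fst (cons_rVK x)).
  apply/seteqP; split => x /=.
    move=> H; split; first by have := H ord0; rewrite E0 /A/= in_itv.
    by move=> i; have := H (lift ord0 i); rewrite E !mxE.
  move=> [H1 H2] i; case: (unliftP ord0 i) => [j ->|->].
    by rewrite E; have := H2 j; rewrite !mxE.
  by move: H1; rewrite E0 /A/= in_itv.
rewrite product_measure1E; [|exact: measurable_itv|exact: measurable_box].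
rewrite IH; last by move=> i; rewrite !mxE.
have eA : (lebesgue_measure A = (b ord0 ord0 - a ord0 ord0)%:E)%E.
  rewrite /A lebesgue_measure_itv/= lte_fin; case: ltP => // ba.
  by rewrite (@le_anti _ _ (a ord0 ord0) (b ord0 ord0)) ?subrr// ab ba.
by rewrite [X in (X * _)%E]eA -EFinM; congr (_ * _)%:E; apply: eq_bigr => i _;
  rewrite !mxE.
Qed.

End lebesgue_rV.

(* R^d with the sigma-algebra of its Lebesgue (not only Borel) measurable sets. *)
Notation lebesgue_rV_type R d :=
  (caratheodory_type (@borel_lebesgue_rV R d)^*%mu).

Definition lebesgue_measurable {R : realType} {d : nat} (A : set 'rV[R]_d) :=
  @measurable _ (lebesgue_rV_type R d) A.

Section exponential_polynomials.
Context {R : realType}.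

(* e^(i t) *)
Definition expi (t : R) : R[i] := (cos t +i* sin t)%C.

Definition dotp {d : nat} (u v : 'rV[R]_d) : R := \sum_(i < d) u ord0 i * v ord0 i.

Definition exp_poly {d M : nat} (a : 'I_M -> R[i]) (xi : 'I_M -> 'rV[R]_d)
    (x : 'rV[R]_d) : R[i] :=
  \sum_(j < M) a j * expi (dotp (xi j) x).

Definition L2norm {d : nat} (D : set 'rV[R]_d) (f : 'rV[R]_d -> R[i]) : \bar R :=
  'N[@lebesgue_rV R d]_2%:E[(fun x : lebesgue_rV_type R d =>
    (ComplexField.Normc.normc (f x))%:E) \_ D].

Lemma L2norm_sqr (d : nat) (D : set 'rV[R]_d) (f : 'rV[R]_d -> R[i]) :
  (L2norm D f ^+ 2 = \int[@lebesgue_rV R d]_(x in D)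
     ((ComplexField.Normc.normc (f x)) ^+ 2)%:E)%E.
Proof.
have normc_ge0 (z : R[i]) : 0 <= ComplexField.Normc.normc z.
  by case: z => u v; exact: sqrtr_ge0.
have sqrE (y : \bar R) : (0 <= y)%E -> (y ^+ 2 = y `^ 2)%E.
  case: y => [r| |]// r0; last by rewrite expe2 mulyy/= pnatr_eq0.
  by rewrite -EFin_expe poweR_EFin powR_mulrn.
rewrite sqrE ?Lnorm_ge0// /L2norm poweR_Lnorm ?pnatr_eq0// [RHS]integral_mkcond.
apply: eq_integral => x _; rewrite !patchE; case: ifPn => _.
- by rewrite gee0_abs ?lee_fin// poweR_EFin powR_mulrn.
- by rewrite abse0 poweR0r// pnatr_eq0.
Qed.

End exponential_polynomials.

(* Main.v *)
(* For M frequencies and any step h, the linear recurrence whose characteristic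
   polynomial has the roots exp(i xi_j h) gives Turan's bound |p(x)| <= 2^M max_(1 <= k <= M) |p(x + k h)|,
   in which the frequencies do not appear.  In dimension one, if A almost fills
   an interval J, then for x in J some h makes all x + k h land where p is
   controlled by its L2 norm on A (Chebyshev); small steps h then propagate the
   sup bound from J to any bounded interval.  The constant depends on A only
   through J, and this uniformity makes an induction on the dimension possible:
   if E is the set of t for which the slice V_t admits the constant 1/(n+1), an
   interval J is almost filled by E for some n, hence also by the set of those t
   where this inequality holds for one given p.  The latter set is measurable
   although E need not be, and Tonelli concludes. *)
From HB Require Import structures.
Require Import Defs.
From mathcomp Require Import all_boot all_order all_algebra.
From mathcomp Require Import complex.
From mathcomp Require Import all_classical all_reals all_analysis.
From mathcomp Require Import measurable_realfun.
From mathcomp Require Import ring lra.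
Import Order.TTheory GRing.Theory Num.Theory.
Import numFieldNormedType.Exports.
Local Open Scope classical_set_scope.
Local Open Scope ring_scope.

(** * Turan's bound for power sums and for exponential sums *)

Lemma power_sum_bound (C : numDomainType) (M : nat) (b z : 'I_M -> C) (m : C) :
  0 <= m -> (forall j, `|z j| = 1) ->
  (forall k, (0 < k <= M)%N -> `|\sum_(j < M) b j * z j ^+ k| <= m) ->
  `|\sum_(j < M) b j| <= m *+ (2 ^ M).-1.
Proof.
(* With [s k] the k-th power sum and [w] the last root, [s (k+1) - w * s k] is a
   power sum with one term less. *)
elim: M => [|M IH] in b z m *; move=> m0 z1 H.
  by rewrite big_ord0 normr0.
set w := z ord_max.
pose z' j := z (widen_ord (leqnSn M) j).
pose b' j := b (widen_ord (leqnSn M) j) * (z' j - w).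
have E k : \sum_(j < M) b' j * z' j ^+ k =
    \sum_(j < M.+1) b j * z j ^+ k.+1 - w * \sum_(j < M.+1) b j * z j ^+ k.
  rewrite !big_ord_recr /= mulrDr opprD addrACA mulr_sumr -sumrB.
  rewrite [X in _ = _ + X](_ : _ = 0) ?addr0; last by rewrite -/w exprS; ring.
  by apply: eq_bigr => j _; rewrite /b' /z' exprS; ring.
have bE : \sum_(j < M.+1) b j = \sum_(j < M.+1) b j * z j ^+ 0.
  by apply: eq_bigr => j _; rewrite expr0 mulr1.
have w1 : `|w| = 1 by exact: z1.
have := IH b' z' (m *+ 2).
rewrite mulrn_wge0// => /(_ isT (fun j => z1 _)) H'.
have {}H' : `|\sum_(j < M) b' j| <= m *+ 2 *+ (2 ^ M).-1.
  apply: H' => k /andP[k0 kM]; rewrite E mulr2n.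
  apply: (le_trans (ler_normB _ _)); apply: lerD.
    by apply: H; rewrite /= ltnS.
  by rewrite normrM w1 mul1r; apply: H; rewrite k0 ltnW.
have E0 : \sum_(j < M) b' j = \sum_(j < M) b' j * z' j ^+ 0.
  by apply: eq_bigr => j _; rewrite expr0 mulr1.
rewrite E0 E -bE in H'.
(* Since [|w| = 1], the sum at exponent 0 has the norm of [w * s 0 = s 1 - (s 1 - w * s 0)]. One [m]
   is added to the bound for [m] doubled, so the constants satisfy c(M+1) = 2 c(M) + 1. *)
have -> : (2 ^ M.+1).-1 = (2 * (2 ^ M).-1 + 1)%N.
  by rewrite expnS; have := expn_gt0 2 M; case: (2 ^ M)%N => // n _; rewrite mulnS addn1.
rewrite mulrnDr mulrnA mulr1n -[X in X <= _]mul1r -w1 -normrM -normrN.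
rewrite (_ : - _ = (\sum_(j < M.+1) b j * z j ^+ 1 - w * (\sum_(i < M.+1) b i))
   - \sum_(j < M.+1) b j * z j ^+ 1); last by ring.
apply: (le_trans (ler_normB _ _)); apply: lerD => //.
exact: H.
Qed.

Section expi.
Context {R : realType}.
Implicit Types s t : R.

Lemma expiD s t : expi (s + t) = expi s * expi t.
Proof. by rewrite /expi cosD sinD; simpc; rewrite [X in (_ +i* X)%C]addrC. Qed.

Lemma expi_norm t : `|expi t| = 1.
Proof. by rewrite normc_def /= cos2Dsin2 sqrtr1. Qed.

Lemma expiMn t k : expi (t *+ k) = expi t ^+ k.
Proof.
elim: k => [|k IH]; first by rewrite mulr0n expr0 /expi cos0 sin0.
by rewrite mulrS exprS expiD IH.
Qed.

End expi.

Definition exp_sum {R : realType} {M : nat} (a : 'I_M -> R[i]) (w : 'I_M -> R)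
  (t : R) : R[i] := \sum_(j < M) a j * expi (w j * t).

(** The squared modulus as a real polynomial in the two parts: no square root occurs, and it is the
    integrand of the squared L2 norm. *)
Definition sqc {R : rcfType} (z : R[i]) : R := complex.Re z ^+ 2 + complex.Im z ^+ 2.

Lemma sqcE {R : rcfType} (z : R[i]) : ComplexField.Normc.normc z ^+ 2 = sqc z.
Proof. by case: z => x y; rewrite sqr_sqrtr// addr_ge0 ?sqr_ge0. Qed.

Lemma sqc_ge0 {R : rcfType} (z : R[i]) : 0 <= sqc z.
Proof. by rewrite addr_ge0 ?sqr_ge0. Qed.
Hint Extern 0 (is_true (0 <= sqc _)) => solve [exact: sqc_ge0] : core.

Lemma sqc_le {R : rcfType} (z : R[i]) (m : R) : 0 <= m ->
  (sqc z <= m) = (`|z| <= (Num.sqrt m)%:C%C).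
Proof.
by move=> m0; rewrite normc_def lecR ler_sqrt.
Qed.

(** Along the progression [x + h *+ k] the sum is a power sum in the unimodular numbers
    [expi (w j * h)], with the phases at [x] absorbed in the coefficients. The factor [4 ^+ N] is
    the square of [2 ^+ N], as [sqc] is a squared modulus. *)
Lemma exp_sum_turan {R : realType} (N M : nat) (a : 'I_M -> R[i]) (w : 'I_M -> R)
    (x h m : R) : (M <= N)%N -> 0 <= m ->
  (forall k, (0 < k <= N)%N -> sqc (exp_sum a w (x + h *+ k)) <= m) ->
  sqc (exp_sum a w x) <= 4 ^+ N * m.
Proof.
move=> MN m0 H.
have E k : exp_sum a w (x + h *+ k) =
    \sum_(j < M) (a j * expi (w j * x)) * expi (w j * h) ^+ k.
  apply: eq_bigr => j _; rewrite -expiMn -mulrnAr -mulrA -expiD; congr (_ * expi _).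
  by rewrite mulrDr.
have s0 : 0 <= (Num.sqrt m)%:C%C :> R[i] by rewrite lecR sqrtr_ge0.
have := @power_sum_bound _ M (fun j => a j * expi (w j * x))
  (fun j => expi (w j * h)) _ s0 (fun j => expi_norm _).
move=> P; rewrite sqc_le ?mulr_ge0 ?exprn_ge0//.
rewrite /exp_sum; apply: le_trans (P _) _.
  move=> k /andP[k0 kM]; rewrite -E -sqc_le//; apply: H.
  by rewrite k0 (leq_trans kM).
rewrite sqrtrM ?exprn_ge0// (_ : 4 ^+ N = (2 ^+ N) ^+ 2); last first.
  by rewrite -exprM mulnC exprM; congr (_ ^+ _); ring.
rewrite sqrtr_sqr ger0_norm ?exprn_ge0// -rmorphMn lecR -[X in X <= _]mulr_natl.
apply: ler_wpM2r; first exact: sqrtr_ge0.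
rewrite -natrX ler_nat (leq_trans (leq_pred _))//.
by rewrite leq_exp2l.
Qed.

(** * Outer Lebesgue measure on the line, and measurability of exponential sums *)

Lemma lebesgue_measure_affine_le {R : realType} (x : R) (k : nat) (D : set R) :
  (0 < k)%N ->
  (lebesgue_measure [set h : R | D (x + h *+ k)%R] <= lebesgue_measure D)%E.
Proof.
move=> k0; have kR0 : 0 < k%:R :> R by rewrite ltr0n.
have k1 : 1 <= k%:R :> R by rewrite ler1n.
(* As [D] is arbitrary, the argument is on coverings: a covering of [D] by half-open intervals pulls
   back to one of the preimage, with lengths divided by [k]. *)
apply/le_ereal_inf_tmp => _ [A [mA DA] <-].
have AE i : exists p : R * R, [/\ p.1 <= p.2 & A i = `]p.1, p.2]%classic].
  case/ocitvP: (mA i) => [->|[p p12 ->]]; last by exists p; split => //; exact: ltW.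
  by exists (0, 0); split; rewrite //= set_itv_ge// bnd_simp ltxx.
pose p i := projT1 (cid (AE i)).
have p12 i : (p i).1 <= (p i).2 by rewrite /p; case: cid => ? [].
have Ap i : A i = `](p i).1, (p i).2]%classic by rewrite /p; case: cid => ? [].
pose B i : set (ocitv_type R) :=
  `](((p i).1 - x) / k%:R), (((p i).2 - x) / k%:R)]%classic.
apply: (@le_trans _ _ (\sum_(i <oo) wlength idfun (B i))%E).
  apply: ereal_inf_lbound; exists B => //; split.
    by move=> i; exact: is_ocitv.
  move=> h /= /DA[i _]; rewrite Ap /= => xh; exists i => //.
  move: xh; rewrite /B /= !in_itv/= ltr_pdivrMr// ler_pdivlMr// -[h *+ k]mulr_natr.
  by rewrite ltrBlDl lerBrDl.
apply: lee_nneseries => [i _ _|i _]; first exact: wlength_ge0.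
rewrite [X in (_ <= X)%E](_ : _ = ((p i).2 - (p i).1)%:E); last first.
  by rewrite Ap; exact: wlength_itv_bnd.
rewrite /B wlength_itv_bnd; last first.
  by rewrite ler_pdivrMr// divfK ?gt_eqF// lerB.
rewrite lee_fin/= -mulrBl opprD addrACA subrr addr0.
by rewrite ler_pdivrMr// ler_peMr// subr_ge0.
Qed.

(* A covering of [E] by intervals that is almost optimal must contain an
   interval that is almost filled by [E]; [E] need not be measurable, in which
   case [lebesgue_measure] is the outer measure. *)
Lemma exists_dense_interval {R : realType} (E : set R) (e : R) :
  0 < e <= 1 -> (0 < lebesgue_measure E)%E -> (lebesgue_measure E < +oo)%E ->
  exists a b : R, a < b /\
    (((1 - e) * (b - a))%:E < lebesgue_measure (E `&` `]a, b]%classic))%E.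
Proof.
move=> /andP[e0 e1] E0 Eoo; apply: contrapT => /forallNP H.
have {}H a b : a <= b ->
    (lebesgue_measure (E `&` `]a, b]%classic) <= ((1 - e) * (b - a))%:E)%E.
  rewrite le_eqVlt => /orP[/eqP <-|ab].
    rewrite set_itv_ge ?setI0 ?bnd_simp ?ltxx// measure0.
    by rewrite subrr mulr0.
  by rewrite leNgt; apply/negP => abE; apply: (H a); exists b.
have fE : lebesgue_measure E \is a fin_num by rewrite ge0_fin_numE.
set m := fine (lebesgue_measure E).
have mE : lebesgue_measure E = m%:E by rewrite fineK.
have m0 : 0 < m by rewrite -lte_fin -mE.
have em0 : 0 < e * m by rewrite mulr_gt0.
have [_ [/= A [mA EA] <-]] := lb_ereal_inf_adherent em0 fE.
set S := (\sum_(0 <= k <oo) _)%E => SE.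
(* The covering has total length below [(1 + e) * m], so this would give m <= (1 - e)(1 + e) m <
   m. *)
suff : (lebesgue_measure E <= (1 - e)%:E * S)%E.
  rewrite leNgt => /negP; apply.
  apply: (@le_lt_trans _ _ ((1 - e)%:E * (m%:E + (e * m)%:E))%E).
    by apply: lee_wpmul2l; rewrite ?lee_fin ?subr_ge0// -mE; exact: ltW.
  rewrite mE -EFinD -EFinM lte_fin -subr_gt0.
  rewrite (_ : _ - _ = e ^+ 2 * m); last by ring.
  by rewrite mulr_gt0// exprn_gt0.
have EAE : E = \bigcup_i (E `&` A i).
  by rewrite -setI_bigcupr; apply/esym/setIidPl.
rewrite [X in (lebesgue_measure X <= _)%E]EAE.
apply: (le_trans (outer_measure_sigma_subadditive ((wlength idfun)^*)%mu _)).
rewrite -nneseriesZl => [|i _]; last exact: wlength_ge0.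
apply: lee_nneseries => [i _ _|i _]; first exact: outer_measure_ge0.
case/ocitvP: (mA i) => [->|[[a b]/= ab ->]].
  by rewrite setI0 outer_measure0 wlength0 mule0.
rewrite [X in (_ <= _ * X)%E](_ : _ = (b - a)%:E); last first.
  by apply: wlength_itv_bnd; exact: ltW.
exact: (H a b (ltW ab)).
Qed.

Lemma sume_const_ord {R : realDomainType} n (y : \bar R) :
  (\sum_(i < n) y = n%:R%:E * y)%E.
Proof.
elim: n => [|n IH]; first by rewrite big_ord0 mul0e.
by rewrite big_ord_recr/= IH -natr1 EFinD ge0_muleDl ?lee_fin// mul1e.
Qed.

Section measurable_exponential_sums.
Context d (T : measurableType d) {R : realType}.

Lemma measurable_sqc_sum M (a : 'I_M -> R[i]) (u : 'I_M -> T -> R) :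
  (forall j, measurable_fun [set: T] (u j)) ->
  measurable_fun [set: T] (fun t => sqc (\sum_(j < M) a j * expi (u j t))).
Proof.
move=> mu.
have mc j : measurable_fun [set: T] (fun t => cos (u j t)).
  by apply: measurableT_comp (mu j);
    apply: continuous_measurable_fun; exact: continuous_cos.
have ms j : measurable_fun [set: T] (fun t => sin (u j t)).
  by apply: measurableT_comp (mu j);
    apply: continuous_measurable_fun; exact: continuous_sin.
rewrite /sqc; apply: measurable_funD; apply: measurable_funX.
- rewrite (_ : (fun t => _) = fun t => \sum_(j < M)
    (complex.Re (a j) * cos (u j t) - complex.Im (a j) * sin (u j t))); last first.
    by apply/funext => t; rewrite raddf_sum; apply: eq_bigr => j _; case: (a j).
  apply: measurable_sum => j; apply: measurable_funB; exact: measurable_funM.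
- rewrite (_ : (fun t => _) = fun t => \sum_(j < M)
    (complex.Re (a j) * sin (u j t) + complex.Im (a j) * cos (u j t))); last first.
    by apply/funext => t; rewrite raddf_sum; apply: eq_bigr => j _; case: (a j).
  apply: measurable_sum => j; apply: measurable_funD; exact: measurable_funM.
Qed.

End measurable_exponential_sums.

(** * From L2 control on a dense part of an interval to pointwise bounds *)

Section one_dimension.
Context {R : realType}.
Local Notation mu := (@lebesgue_measure R).
Implicit Types (N M k n : nat) (c r L m x : R) (A B : set R).

(** A union bound over [k]: the admissible steps [h] fill an interval of length [r / N], while those
    sending some [x + h *+ k] outside [B] have total measure below [r / N]. Some step is therefore
    good for all [k] at once. *)
Lemma exp_sum_sup_dense N M (a : 'I_M -> R[i]) (w : 'I_M -> R) c r B m x :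
  (0 < N)%N -> (M <= N)%N -> 0 < r -> 0 <= m ->
  ((N%:R)%:E * mu (`](c - r)%R, (c + r)%R] `\` B) < (r / N%:R)%:E)%E ->
  (forall t, B t -> sqc (exp_sum a w t) <= m) ->
  c - r < x <= c + r -> sqc (exp_sum a w x) <= 4 ^+ N * m.
Proof.
move=> N0 MN r0 m0 muB HB xJ.
have NR0 : 0 < N%:R :> R by rewrite ltr0n.
set q := r / N%:R; have q0 : 0 < q by rewrite divr_gt0.
have qN : q * N%:R = r by rewrite /q divfK// gt_eqF.
suff [h Hh] : exists h, forall k, (0 < k <= N)%N -> B (x + h *+ k).
  by apply: (@exp_sum_turan _ N M a w x h m MN m0) => k kN; exact/HB/Hh.
set J := `]c - r, c + r]%classic : set R.
(* Steps pointing from [x] towards the centre [c], of size at most [q]: even [N] of them cover only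
   a distance [r], so the progression stays in [J]. *)
have [H muH HJ] : exists2 H : set R, mu H = q%:E &
    forall h k, H h -> (0 < k <= N)%N -> J (x + h *+ k).
  case/andP: xJ => xJ1 xJ2.
  have kq k : (0 < k <= N)%N -> 1 <= k%:R :> R /\ k%:R <= N%:R :> R.
    by rewrite ler_nat ler1n => /andP.
  have [cx|xc] := ltP c x.
    exists `[- q, 0]%classic.
      by rewrite lebesgue_measure_itv/= lte_fin oppr_lt0 q0 -EFinB sub0r opprK.
    move=> h k /=; rewrite /J /= !in_itv/= -[h *+ k]mulr_natr => /andP[h1 h2] /kq[k1 k2].
    by apply/andP; split; nra.
  exists `[0, q]%classic.
    by rewrite lebesgue_measure_itv/= lte_fin q0 -EFinB subr0.
  move=> h k /=; rewrite /J /= !in_itv/= -[h *+ k]mulr_natr => /andP[h1 h2] /kq[k1 k2].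
  by apply/andP; split; nra.
apply: contrapT => /forallNP nH; move: muB; apply/negP; rewrite -leNgt -/q -muH.
(* The bad steps for the exponent [k.+1]; the shift matches indices [k < N] with exponents from 1 to
   [N]. *)
pose D k := [set h : R | (J `\` B) (x + h *+ k.+1)].
apply: (@le_trans _ _ (mu (\big[setU/set0]_(k < N) D k))).
  apply: (le_outer_measure ((wlength idfun)^*)%mu) => h Hh.
  have /existsNP[k /not_implyP[kN nB]] := nH h.
  case: k => // k in kN nB *.
  rewrite -bigcup_mkord; exists k => //; split => //; exact: HJ.
apply: (le_trans (outer_measure_subadditive ((wlength idfun)^*)%mu _ _)).
rewrite -sume_const_ord.
apply: lee_sum => k _; exact: lebesgue_measure_affine_le.
Qed.

(** Each round enlarges the radius by [r / N] at the cost of a factor [4 ^+ N]. From a point of the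
    new annulus, the first step of length [r / N] towards [c] already enters the controlled
    interval, and [N] such steps do not pass beyond [c]. *)
Lemma exp_sum_sup_growth N M (a : 'I_M -> R[i]) (w : 'I_M -> R) c r m n x :
  (0 < N)%N -> (M <= N)%N -> 0 < r -> 0 <= m ->
  (forall t, `|t - c| < r -> sqc (exp_sum a w t) <= m) ->
  `|x - c| < r + r / N%:R *+ n -> sqc (exp_sum a w x) <= (4 ^+ N) ^+ n * m.
Proof.
move=> N0 MN r0 m0 H.
have NR0 : 0 < N%:R :> R by rewrite ltr0n.
set q := r / N%:R; have q0 : 0 < q by rewrite divr_gt0.
have qN : q * N%:R = r by rewrite /q divfK// gt_eqF.
elim: n x => [|n IH] x; first by rewrite mulr0n addr0 expr0 mul1r; exact: H.
have K0 k : 0 <= (4 ^+ N) ^+ k :> R by rewrite !exprn_ge0.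
have q0n : 0 <= q *+ n by rewrite mulrn_wge0// ltW.
rewrite mulrS => xn; have [xlt|xge] := ltP `|x - c| (r + q *+ n).
  apply: (le_trans (IH _ xlt)); rewrite ler_wpM2r// [leRHS]exprS ler_peMl//.
  by rewrite exprn_ege1// ler1n.
rewrite exprS -mulrA.
have kq k : (0 < k <= N)%N -> 1 <= k%:R :> R /\ k%:R <= N%:R :> R.
  by rewrite ler_nat ler1n => /andP.
have [cx|xc] := ltP c x.
  apply: (@exp_sum_turan _ N M a w x (- q)) => //; first by rewrite mulr_ge0.
  move=> k /kq[k1 k2]; apply: IH; move: xge xn.
  rewrite gtr0_norm ?subr_gt0// => xge xn.
  rewrite -[_ *+ k]mulr_natr ltr_norml; apply/andP; split; nra.
apply: (@exp_sum_turan _ N M a w x q) => //; first by rewrite mulr_ge0.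
move=> k /kq[k1 k2]; apply: IH; move: xge xn.
rewrite ler0_norm ?subr_le0// => xge xn.
rewrite -[_ *+ k]mulr_natr ltr_norml; apply/andP; split; nra.
Qed.

Lemma exp_sum_L2_bound N c r L : (0 < N)%N -> 0 < r -> exists2 kappa : R, 0 < kappa &
  forall A, measurable (A : set (measurableTypeR R)) ->
   (mu (`](c - r)%R, (c + r)%R] `\` A) <= (r / (2 * N%:R ^+ 2))%:E)%E ->
  forall M (a : 'I_M -> R[i]) (w : 'I_M -> R) x, (M <= N)%N -> `|x| <= L ->
  ((kappa * sqc (exp_sum a w x))%:E <=
     \int[mu]_(t in A) (sqc (exp_sum a w t))%:E)%E.
Proof.
move=> N0 r0.
have NR0 : 0 < N%:R :> R by rewrite ltr0n.
set q := r / N%:R; have q0 : 0 < q by rewrite divr_gt0.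
set d := r / (2 * N%:R ^+ 2).
have d0 : 0 < d by rewrite divr_gt0 ?mulr_gt0 ?exprn_gt0.
(* Enough rounds of growth to reach all of [[-L, L]], a number fixed before [A] and the sum are
   given. *)
pose n := Num.bound ((`|L| + `|c|) / q).
have nL x : `|x| <= L -> `|x - c| < r + q *+ n.
  move=> xL; apply: (le_lt_trans (ler_normB _ _)).
  have : `|L| + `|c| < q *+ n.
    rewrite -[q *+ n]mulr_natl -ltr_pdivrMr//.
    by apply: archi_boundP; rewrite divr_ge0// ?addr_ge0// ltW.
  have := ler_norm L; lra.
(* One factor [4 ^+ N] fills the interval from its dense part; the other [n] factors pay for the
   growth to [[-L, L]]. *)
pose K : R := (4 ^+ N) ^+ n * 4 ^+ N.
have K0 : 0 < K by rewrite mulr_gt0// !exprn_gt0.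
exists (d / (2 * K)); first by rewrite divr_gt0// mulr_gt0.
move=> A mA muA M a w x MN xL.
set f := fun t => sqc (exp_sum a w t).
have mf : measurable_fun [set: measurableTypeR R] f.
  by apply: measurable_sqc_sum => j; exact: measurable_funM.
have [f0|f0] := leP (f x) 0.
  apply: (@le_trans _ _ 0%E).
    by rewrite lee_fin mulr_ge0_le0// ltW// divr_gt0// mulr_gt0.
  by apply: integral_ge0 => t _; rewrite lee_fin.
set m := f x / (2 * K).
have m0 : 0 < m by rewrite divr_gt0// mulr_gt0.
pose D : set (measurableTypeR R) := A `&` [set t | m < f t].
have mD : measurable D.
  apply: measurableI => //.
  rewrite -[X in measurable X]setTI (_ : [set t | _] = f @^-1` `]m, +oo[); last first.
    by apply/seteqP; split => t /=; rewrite in_itv/= andbT.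
  exact: mf.
(* Otherwise the part of the interval outside [A \ D] has measure below [2 * d], and
   [N * (2 * d) = r / N] is the gap that [exp_sum_sup_dense] allows. Then [f x <= K * m = f x / 2],
   against [0 < f x]. *)
have muD : (d%:E <= mu D)%E.
  rewrite leNgt; apply/negP => Dd.
  have : f x <= K * m.
    rewrite /K -mulrA; apply: (@exp_sum_sup_growth N M a w c r) => //.
    - by rewrite mulr_ge0 ?exprn_ge0 ?ltW.
    - move=> t tc.
      apply: (@exp_sum_sup_dense N M a w c r (A `\` D)) => //; first exact: ltW.
      + rewrite -/(`]c - r, c + r]%classic).
        apply: (@le_lt_trans _ _
            ((N%:R)%:E * (mu (`](c - r)%R, (c + r)%R] `\` A) + mu D))%E).
          apply: lee_wpmul2l; first by rewrite lee_fin.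
          apply: (le_trans _ (outer_measureU2 ((wlength idfun)^*)%mu _ _)).
          apply: (le_outer_measure ((wlength idfun)^*)%mu) => s /= [sJ sA].
          have [As|As] := pselect (A s); last by left.
          by right; apply: contrapT => Ds; exact: sA.
        rewrite [X in (_ < X)%E](_ : _ = N%:R%:E * (d%:E + d%:E))%E; last first.
          rewrite -EFinD -EFinM; congr (_%:E); rewrite /d; field.
          by rewrite gt_eqF.
        rewrite lte_pmul2l// ?lte_fin//.
        apply: (@le_lt_trans _ _ (d%:E + mu D)%E); first exact: leeD.
        exact: lee_ltD.
      + by move=> s [As Ds]; rewrite leNgt; apply/negP => ms; exact: Ds.
      + move: tc; rewrite ltr_norml => /andP[]; lra.
    - exact: nL.
  rewrite (_ : K * m = f x / 2); last first.
    by rewrite /m; field; rewrite gt_eqF.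
  by move: f0; lra.
apply: (@le_trans _ _ (m%:E * mu D)%E).
  rewrite (_ : d / _ * _ = m * d); last by rewrite /m /f; field; rewrite gt_eqF.
  by rewrite EFinM; apply: lee_wpmul2l => //; rewrite lee_fin ltW.
rewrite -integral_cst//.
have mfE B' : measurable_fun B' (fun t : measurableTypeR R => (f t)%:E).
  exact/measurable_EFinP/measurable_funTS.
apply: (@le_trans _ _ (\int[mu]_(t in D) (f t)%:E)%E).
  apply: ge0_le_integral => //.
  - by move=> t _; rewrite lee_fin ltW.
  - exact: mfE.
  - by move=> t [_ /= mt]; rewrite lee_fin ltW.
apply: ge0_subset_integral => //.
- exact: mfE.
- by move=> t _; rewrite lee_fin; exact: sqc_ge0.
- by move=> t [].
Qed.
End one_dimension.

(** * Tonelli on rectangles, and slices along the first coordinate *)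

Lemma outer_measure_bigcup_gt0 {R : realType} (T : Type)
    (mu : {outer_measure set T -> \bar R}) (F : (set T)^nat) :
  (0 < mu (\bigcup_n F n))%E -> exists n, (0 < mu (F n))%E.
Proof.
move=> F0; apply: contrapT => /forallNP nF; move: F0; apply/negP; rewrite -leNgt.
apply: (le_trans (outer_measure_sigma_subadditive mu F)).
rewrite eseries0// => n _ _; apply/eqP; rewrite eq_le outer_measure_ge0 andbT.
by rewrite leNgt; exact/negP/nF.
Qed.

Lemma fubini_tonelli_rect d1 d2 (T1 : measurableType d1) (T2 : measurableType d2)
    (R : realType) (m1 : {sigma_finite_measure set T1 -> \bar R})
    (m2 : {sigma_finite_measure set T2 -> \bar R})
    (A : set T1) (B : set T2) (f : T1 * T2 -> \bar R) :
  measurable A -> measurable B -> measurable_fun [set: T1 * T2] f ->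
  (forall z, 0 <= f z)%E ->
  (\int[m1]_(x in A) \int[m2]_(y in B) f (x, y) =
   \int[m2]_(y in B) \int[m1]_(x in A) f (x, y))%E.
Proof.
move=> mA mB mf f0; pose g := f \_ (A `*` B).
have mg : measurable_fun [set: T1 * T2] g.
  by apply/(measurable_restrictT _ (measurableX mA mB)); exact: measurable_funTS.
have g0 z : (0 <= g z)%E by apply: erestrict_ge0.
rewrite [LHS]integral_mkcond [RHS]integral_mkcond.
transitivity (\int[m1]_x \int[m2]_y g (x, y))%E; last rewrite fubini_tonelli//.
  apply: eq_integral => x _; rewrite patchE; case: ifPn => xA.
    rewrite integral_mkcond; apply: eq_integral => y _.
    by rewrite /g !patchE in_setX/= xA.
  rewrite integral0_eq// => y _.
  by rewrite /g patchE in_setX/= (negbTE xA).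
apply: eq_integral => y _; rewrite patchE; case: ifPn => yB.
  rewrite [RHS]integral_mkcond; apply: eq_integral => x _.
  by rewrite /g !patchE in_setX/= yB andbT.
rewrite integral0_eq// => x _.
by rewrite /g patchE in_setX/= (negbTE yB) andbF.
Qed.

Section slices.
Context {R : realType} {d : nat}.
Local Notation mu := (@lebesgue_measure R).
Local Notation nu := (borel_lebesgue_rV d).
Local Open Scope ereal_scope.

Definition slice (V : set 'rV[R]_d.+1) (t : R) : set 'rV[R]_d :=
  [set u | V (cons_rV (t, u))].

Lemma measurable_preimage_cons_rV (V : set 'rV[R]_d.+1) : measurable V ->
  measurable (@cons_rV R d @^-1` V).
Proof. by move=> mV; rewrite -[X in measurable X]setTI; exact: measurable_cons_rV. Qed.

Lemma sliceE (V : set 'rV[R]_d.+1) t : slice V t = xsection (@cons_rV R d @^-1` V) t.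
Proof. by apply/seteqP; split => u; rewrite /xsection/slice/= inE. Qed.

Lemma measurable_slice (V : set 'rV[R]_d.+1) t : measurable V -> measurable (slice V t).
Proof.
move=> mV; rewrite sliceE; apply: measurable_xsection.
exact: measurable_preimage_cons_rV.
Qed.

Lemma borel_lebesgue_rVS_slice (V : set 'rV[R]_d.+1) :
  borel_lebesgue_rV d.+1 V = \int[mu]_t nu (slice V t).
Proof. by apply: eq_integral => t _; rewrite /= sliceE. Qed.

Lemma measurable_fun_slice (V : set 'rV[R]_d.+1) : measurable V ->
  measurable_fun [set: measurableTypeR R] (fun t => nu (slice V t)).
Proof.
move=> mV; under eq_fun do rewrite sliceE.
apply: measurable_fun_xsection.
exact: measurable_preimage_cons_rV.
Qed.

Section integral_slice.
Context (V : set 'rV[R]_d.+1) (f : 'rV[R]_d.+1 -> \bar R).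
Hypotheses (mV : measurable V) (mf : measurable_fun [set: 'rV[R]_d.+1] f)
  (f0 : forall x, 0 <= f x).

Let g := (f \_ V) \o @cons_rV R d.

Let mg : measurable_fun [set: measurableTypeR R * 'rV[R]_d] g.
Proof.
apply: measurableT_comp; last exact: measurable_cons_rV.
by apply/(measurable_restrictT _ mV); exact: measurable_funTS.
Qed.

Let g0 z : 0 <= g z. Proof. by apply: erestrict_ge0. Qed.

Let gE t : \int[nu]_(u in slice V t) f (cons_rV (t, u)) = \int[nu]_u g (t, u).
Proof.
rewrite integral_mkcond; apply: eq_integral => u _; rewrite /g /= !patchE.
by congr (if _ then _ else _); apply/idP/idP; rewrite !inE.
Qed.

Lemma measurable_fun_integral_slice : measurable_fun [set: measurableTypeR R]
  (fun t => \int[nu]_(u in slice V t) f (cons_rV (t, u))).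
Proof.
under eq_fun do rewrite gE.
exact: (measurable_fun_fubini_tonelli_F _ mg g0).
Qed.

Lemma integral_slice : \int[borel_lebesgue_rV d.+1]_(x in V) f x =
  \int[mu]_t \int[nu]_(u in slice V t) f (cons_rV (t, u)).
Proof.
rewrite integral_mkcond.
rewrite (ge0_integral_pushforward (@measurable_cons_rV R d))//; last first.
- by move=> x _; apply: erestrict_ge0.
- by apply/(measurable_restrictT _ mV); exact: measurable_funTS.
rewrite preimage_setT (fubini_tonelli1 _ mg g0).
by apply: eq_integral => t _; rewrite gE.
Qed.

End integral_slice.

End slices.

(** * L2 comparison on intervals, and exponential polynomials on slices and cubes *)

Lemma exp_sum_L2_interval {R : realType} N (c r L : R) :
  (0 < N)%N -> 0 < r -> exists2 kappa : R, 0 < kappa &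
  forall A, measurable (A : set (measurableTypeR R)) ->
   (lebesgue_measure (`](c - r)%R, (c + r)%R] `\` A) <= (r / (2 * N%:R ^+ 2))%:E)%E ->
  forall M (a : 'I_M -> R[i]) (w : 'I_M -> R), (M <= N)%N ->
  (kappa%:E * \int[lebesgue_measure]_(t in `[(- L)%R, L]) (sqc (exp_sum a w t))%:E <=
     \int[lebesgue_measure]_(t in A) (sqc (exp_sum a w t))%:E)%E.
Proof.
move=> N0 r0; have [k k0 H] := @exp_sum_L2_bound R N c r L N0 r0.
(* The pointwise bound is integrated over [[-L, L]], of length at most [l]. The absolute value is
   there because [L] may be negative, the 1 to allow division by [l]. *)
pose l : R := 2 * `|L| + 1.
have l0 : 0 < l by rewrite ltr_wpDl// mulr_ge0.
exists (k / l); first by rewrite divr_gt0.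
move=> A mA muA M a w MN.
set I := (X in (_ <= X)%E).
have {}H x : `|x| <= L -> ((k * sqc (exp_sum a w x))%:E <= I)%E.
  exact: H A mA muA M a w x MN.
have I0 : (0 <= I)%E by apply: integral_ge0 => t _; rewrite lee_fin.
move: I I0 H => [i i0 H|_ _|//]; last by rewrite leey.
have mf : measurable_fun [set: measurableTypeR R] (fun t => (sqc (exp_sum a w t))%:E).
  by apply/measurable_EFinP/measurable_sqc_sum => j; exact: measurable_funM.
have ik0 : 0 <= i / k by rewrite divr_ge0// ltW.
apply: (@le_trans _ _ ((k / l)%:E * ((i / k) * l)%:E)%E); last first.
  by rewrite -EFinM lee_fin; rewrite (_ : k / l * _ = i)//; field; rewrite !gt_eqF.
apply: lee_wpmul2l; first by rewrite lee_fin ltW// divr_gt0.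
apply: (@le_trans _ _ (\int[lebesgue_measure]_(t in `[(- L)%R, L]) (i / k)%:E)%E).
  apply: ge0_le_integral => //.
  - by move=> t _; rewrite lee_fin.
  - exact: measurable_funTS.
  - move=> t /=; rewrite in_itv/= -ler_norml => /H; rewrite !lee_fin => tH.
    by rewrite ler_pdivlMr// mulrC.
rewrite (integral_cst _ _ (i / k)%:E)//= [((i / k) * l)%:E]EFinM.
apply: lee_wpmul2l => //.
rewrite lebesgue_measure_itv/=; case: ifP => _; rewrite -?EFinB lee_fin ?ltW//.
by rewrite /l; have := ler_norm L; lra.
Qed.

Section slice_exp_poly.
Context {R : realType}.

Lemma cons_rV0 d (t : R) (u : 'rV[R]_d) : cons_rV (t, u) ord0 ord0 = t.
Proof. exact: (congr1 fst (cons_rVK (t, u))). Qed.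

Lemma cons_rVS d (t : R) (u : 'rV[R]_d) i :
  cons_rV (t, u) ord0 (lift ord0 i) = u ord0 i.
Proof. by have /(congr1 snd)/rowP/(_ i) := cons_rVK (t, u); rewrite mxE. Qed.

Lemma dotp_cons_rV d (y : 'rV[R]_d.+1) (t : R) u :
  dotp y (cons_rV (t, u)) = y ord0 ord0 * t + dotp (uncons_rV y).2 u.
Proof.
rewrite /dotp big_ord_recl cons_rV0; congr (_ + _).
by apply: eq_bigr => i _; rewrite cons_rVS mxE.
Qed.

(** Freezing the first coordinate (or, in [exp_poly_line], all the others) moves phases into the
    coefficients. The number of terms, the only feature of the polynomial that the constants depend
    on, is unchanged. *)
Lemma exp_poly_slice d M (a : 'I_M -> R[i]) (xi : 'I_M -> 'rV[R]_d.+1) t u :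
  exp_poly a xi (cons_rV (t, u)) =
  exp_poly (fun j => a j * expi (xi j ord0 ord0 * t)) (fun j => (uncons_rV (xi j)).2) u.
Proof. by apply: eq_bigr => j _; rewrite dotp_cons_rV expiD mulrA. Qed.

Lemma exp_poly_line d M (a : 'I_M -> R[i]) (xi : 'I_M -> 'rV[R]_d.+1) t u :
  exp_poly a xi (cons_rV (t, u)) =
  exp_sum (fun j => a j * expi (dotp (uncons_rV (xi j)).2 u)) (fun j => xi j ord0 ord0) t.
Proof. by apply: eq_bigr => j _; rewrite dotp_cons_rV addrC expiD mulrA. Qed.

Lemma measurable_sqc_exp_poly d M (a : 'I_M -> R[i]) (xi : 'I_M -> 'rV[R]_d) :
  measurable_fun [set: 'rV[R]_d] (fun x => (sqc (exp_poly a xi x))%:E).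
Proof.
apply/measurable_EFinP/measurable_sqc_sum => j.
apply: measurable_sum => i; apply: measurable_funM => //.
exact: measurable_coord_rV.
Qed.

End slice_exp_poly.

(** Stands in for [Omega] in the induction on the dimension: its slices are again cubes with the
    same [L], or empty. *)
Definition cube {R : realType} d (L : R) : set 'rV[R]_d :=
  [set x | forall i, - L <= x ord0 i <= L].

Lemma measurable_cube {R : realType} d (L : R) : measurable (cube d L).
Proof.
rewrite (_ : cube d L = [set x | forall i, (const_mx (- L) : 'rV[R]_d) ord0 i <=
    x ord0 i <= (const_mx L : 'rV[R]_d) ord0 i]); first exact: measurable_box.
by apply/seteqP; split => x H i; have := H i; rewrite !mxE.
Qed.

Lemma slice_cube {R : realType} d (L t : R) :
  slice (cube d.+1 L) t = if - L <= t <= L then cube d L else set0.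
Proof.
apply/seteqP; split => u.
  rewrite /slice/= => H; have := H ord0; rewrite cons_rV0 => -> i.
  by have := H (lift ord0 i); rewrite cons_rVS.
case: ifP => // tL H i; have [j ->|->] := unliftP ord0 i.
  by rewrite cons_rVS; exact: H.
by rewrite cons_rV0.
Qed.

Lemma integral_cubeS {R : realType} d (L : R) (f : 'rV[R]_d.+1 -> \bar R) :
  measurable_fun [set: 'rV[R]_d.+1] f -> (forall x, 0 <= f x)%E ->
  (\int[borel_lebesgue_rV d.+1]_(x in cube d.+1 L) f x =
   \int[lebesgue_measure]_(t in `[(- L)%R, L])
     \int[borel_lebesgue_rV d]_(u in cube d L) f (cons_rV (t, u)))%E.
Proof.
move=> mf f0; rewrite integral_slice//; last exact: measurable_cube.
rewrite [RHS]integral_mkcond; apply: eq_integral => t _; rewrite patchE slice_cube.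
rewrite mem_setE in_itv/=; case: ifP => // _.
by rewrite integral_set0.
Qed.

Section parameter_integral.
Context d1 d2 (T1 : measurableType d1) (T2 : measurableType d2) (R : realType).
Context (m1 : {sigma_finite_measure set T1 -> \bar R}).
Context (m2 : {sigma_finite_measure set T2 -> \bar R}).
Context (f : T1 * T2 -> \bar R).
Hypotheses (mf : measurable_fun [set: T1 * T2] f) (f0 : forall z, (0 <= f z)%E).

Let measurable_patch C : measurable C -> measurable_fun [set: T1 * T2] (f \_ C).
Proof. by move=> mC; apply/(measurable_restrictT _ mC); exact: measurable_funTS. Qed.

Let patch_ge0 C z : (0 <= (f \_ C) z)%E. Proof. exact: erestrict_ge0. Qed.

Lemma measurable_fun_integral_snd B : measurable B ->
  measurable_fun [set: T1] (fun x => \int[m2]_(y in B) f (x, y))%E.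
Proof.
move=> mB; have mTB : measurable ([set: T1] `*` B) by exact: measurableX.
have := measurable_fun_fubini_tonelli_F (m2 := m2) _
  (measurable_patch _ mTB) (patch_ge0 _).
congr measurable_fun; apply/funext => x.
rewrite [RHS]integral_mkcond; apply: eq_integral => y _.
by rewrite !patchE in_setX/= in_setT.
Qed.

Lemma measurable_fun_integral_fst A : measurable A ->
  measurable_fun [set: T2] (fun y => \int[m1]_(x in A) f (x, y))%E.
Proof.
move=> mA; have mAT : measurable (A `*` [set: T2]) by exact: measurableX.
have := measurable_fun_fubini_tonelli_G (m1 := m1) _
  (measurable_patch _ mAT) (patch_ge0 _).
congr measurable_fun; apply/funext => y.
rewrite [RHS]integral_mkcond; apply: eq_integral => x _.
by rewrite !patchE in_setX/= in_setT andbT.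
Qed.

End parameter_integral.

(** * Induction on the dimension for Borel sets *)

Section borel_case.
Context {R : realType}.
Local Notation mu := (@lebesgue_measure R).
Local Notation nu := (@borel_lebesgue_rV R).

Lemma borel_exp_poly_bound N L d (V : set 'rV[R]_d) : (0 < N)%N ->
  measurable V -> (0 < nu d V)%E ->
  exists2 gamma : R, 0 < gamma &
    forall M (a : 'I_M -> R[i]) (xi : 'I_M -> 'rV[R]_d), (M <= N)%N ->
      (gamma%:E * \int[nu d]_(x in cube d L) (sqc (exp_poly a xi x))%:E <=
       \int[nu d]_(x in V) (sqc (exp_poly a xi x))%:E)%E.
Proof.
move=> N0; elim: d V => [|d IH] V mV V0.
  (* In dimension 0 the space is a single point, which a set of positive measure contains. *)
  exists 1 => // M a xi _; rewrite mul1e.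
  apply: ge0_subset_integral => //; first exact: measurable_cube.
  - apply: measurable_funTS; exact: measurable_sqc_exp_poly.
  - by move=> x _; rewrite lee_fin.
  - move=> x _; move: V0; rewrite /= diracE lte_fin ltr0n lt0b.
    by rewrite inE; rewrite (_ : x = 0)//; apply/rowP => -[].
pose c n : R := n.+1%:R^-1.
have c0 n : 0 < c n by rewrite invr_gt0.
pose E n : set R := [set t | forall M (a : 'I_M -> R[i]) (xi : 'I_M -> 'rV[R]_d),
  (M <= N)%N -> ((c n)%:E * \int[nu d]_(x in cube d L) (sqc (exp_poly a xi x))%:E <=
       \int[nu d]_(x in slice V t) (sqc (exp_poly a xi x))%:E)%E].
have VE : [set t | (0 < nu d (slice V t))%E] `<=` \bigcup_n E n.
  move=> t /= Vt; have [g g0 H] := IH (slice V t) (measurable_slice V t mV) Vt.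
  (* The constant [g] depends on [t]; any [n] above [1 / g] makes [c n] smaller than it. *)
  exists (Num.bound g^-1) => // M a xi MN.
  apply: (le_trans _ (H M a xi MN)); apply: lee_wpmul2r.
    by apply: integral_ge0 => x _; rewrite lee_fin.
  rewrite lee_fin /c -[leRHS]invrK lef_pV2 ?posrE ?invr_gt0//.
  rewrite ltW// (lt_trans (archi_boundP _)) ?invr_ge0 ?ltW// ltr_nat//.
have E0 : (0 < mu (\bigcup_n E n))%E.
  apply: (lt_le_trans _ (le_outer_measure ((wlength idfun)^*)%mu _ _ VE)).
  (* If almost every slice were null, integrating their measures would make [V] null. *)
  rewrite lt0e outer_measure_ge0 andbT; apply/eqP => P0.
  move: V0; rewrite borel_lebesgue_rVS_slice; apply/negP; rewrite -leNgt.
  set P := [set t | _] in P0 *.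
  have mP : measurable (P : set (measurableTypeR R)).
    rewrite -[P]setTI; apply: emeasurable_fun_o_infty => //.
    exact: measurable_fun_slice.
  rewrite [leLHS](_ : _ = \int[mu]_(t in P) nu d (slice V t))%E.
    by rewrite null_set_integral//; apply: measurable_funTS; exact: measurable_fun_slice.
  rewrite [RHS]integral_mkcond; apply: eq_integral => t _; rewrite patchE.
  case: ifPn => //; rewrite notin_setE /P/= => /negP; rewrite -leNgt => t0.
  by apply/eqP; rewrite eq_le t0 measure_ge0.
have [n En0] := outer_measure_bigcup_gt0 _ ((wlength idfun)^*)%mu _ E0.
(* Bounded windows provide the finite outer measure required by [exists_dense_interval]. *)
have Ek : E n = \bigcup_k (E n `&` `]- k%:R, k%:R]%classic).
  apply/seteqP; split => [t Et|t [j _ []//]].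
  exists (Num.bound `|t|) => //; split => //=.
  by rewrite in_itv/=; have := archi_boundP (normr_ge0 t);
    rewrite ltr_norml => /andP[-> /ltW ->].
have [k Ek0] : exists k, (0 < mu (E n `&` `](- k%:R)%R, k%:R]%classic))%E.
  apply: (outer_measure_bigcup_gt0 _ ((wlength idfun)^*)%mu
    (fun j : nat => E n `&` `]- j%:R, j%:R]%classic)).
  by rewrite -Ek.
have Ekoo : (mu (E n `&` `](- k%:R)%R, k%:R]%classic) < +oo)%E.
  apply: (@le_lt_trans _ _ (mu `](- k%:R)%R, k%:R]%classic)).
    by apply: (le_outer_measure ((wlength idfun)^*)%mu) => t [].
  by rewrite lebesgue_measure_itv/=; case: ifP => _; rewrite -?EFinB ltry.
have NR0 : 0 < N%:R :> R by rewrite ltr0n.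
have N1 : 1 <= N%:R :> R by rewrite ler1n.
(* With [u - l = 2 * r], the uncovered length [e * (u - l)] is exactly the gap [r / (2 * N%:R ^+ 2)]
   allowed in dimension one. *)
pose e : R := (4 * N%:R ^+ 2)^-1.
have e01 : 0 < e <= 1.
  rewrite /e invr_gt0 mulr_gt0 ?exprn_gt0//= invf_le1 ?mulr_gt0 ?exprn_gt0//.
  nra.
have [l [u [lu Elu]]] := exists_dense_interval _ _ e01 Ek0 Ekoo.
pose m := (l + u) / 2; pose r := (u - l) / 2.
have r0 : 0 < r by rewrite divr_gt0// subr_gt0.
have mrl : m - r = l by rewrite /m /r; lra.
have mru : m + r = u by rewrite /m /r; lra.
have [k1 k10 H1] := @exp_sum_L2_interval R N m r L N0 r0.
exists (c n * k1); first by rewrite mulr_gt0.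
move=> M a xi MN.
pose f x := (sqc (exp_poly a xi x))%:E.
have mf : measurable_fun [set: 'rV[R]_d.+1] f by exact: measurable_sqc_exp_poly.
have f0 x : (0 <= f x)%E by rewrite lee_fin.
have mfc : measurable_fun [set: measurableTypeR R * 'rV[R]_d] (f \o @cons_rV R d).
  by apply: measurableT_comp mf _; exact: measurable_cons_rV.
have mcube : measurable (cube d L) by exact: measurable_cube.
pose Phi t := (\int[nu d]_(v in cube d L) f (cons_rV (t, v)))%E.
pose Psi t := (\int[nu d]_(v in slice V t) f (cons_rV (t, v)))%E.
have mPsi : measurable_fun [set: measurableTypeR R] Psi.
  exact: measurable_fun_integral_slice.
have mPhi : measurable_fun [set: measurableTypeR R] Phi.
  exact: (@measurable_fun_integral_snd _ _ _ _ _ (nu d) _ mfc (fun=> f0 _) _ mcube).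
have Phi0 t : (0 <= Phi t)%E by exact: integral_ge0.
have Psi0 t : (0 <= Psi t)%E by exact: integral_ge0.
(* For one fixed polynomial the condition compares two measurable functions of [t]; [A] contains
   [E n] whichever polynomial was chosen. *)
pose A : set (measurableTypeR R) := [set t | ((c n)%:E * Phi t <= Psi t)%E].
have mcPhi : measurable_fun [set: measurableTypeR R] (fun t => (c n)%:E * Phi t)%E.
  exact: measurable_funeM.
have mA : measurable A.
  by rewrite -[A]setTI; exact: measurable_lee.
have EA : E n `<=` A.
  move=> t Et; rewrite /A/= /Phi /Psi /f.
  under eq_integral do rewrite exp_poly_slice.
  under [leRHS]eq_integral do rewrite exp_poly_slice.
  exact: Et.
(* Measurability of [A] turns the lower bound on the outer measure of [E n] within the interval into
   an upper bound on the complement of [A]. *)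
have muA : (mu (`](m - r)%R, (m + r)%R] `\` A) <= (r / (2 * N%:R ^+ 2))%:E)%E.
  rewrite mrl mru.
  set J := `]l, u]%classic in Elu *.
  have muJ : mu J = (u - l)%:E by rewrite lebesgue_measure_itv/= lte_fin lu -EFinB.
  have mJ : measurable (J : set (measurableTypeR R)) by exact: measurable_itv.
  rewrite measureD//; last by rewrite [X in (X < _)%E]muJ ltry.
  have JA : (((1 - e) * (u - l))%:E <= mu (J `&` A))%E.
    apply: (le_trans (ltW Elu)).
    apply: (le_outer_measure ((wlength idfun)^*)%mu) => t [[/EA At _] Jt].
    by split.
  apply: (@le_trans _ _ ((u - l)%:E - ((1 - e) * (u - l))%:E)%E).
    by rewrite [X in (X - _ <= _)%E]muJ; apply: leeB.
  rewrite -EFinB lee_fin (_ : _ - _ = e * (u - l)); last by ring.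
  rewrite (_ : e * (u - l) = r / (2 * N%:R ^+ 2)); first exact: lexx.
  by rewrite /e /r; field; rewrite gt_eqF.
have {}H1 v := H1 A mA muA M
  (fun j => a j * expi (dotp (uncons_rV (xi j)).2 v)) (fun j => xi j ord0 ord0) MN.
rewrite (integral_cubeS _ _ f)// (integral_slice _ f)//.
(* Keep only the [t] in [A], where [Psi t] dominates [c n * Phi t]. *)
apply: (@le_trans _ _ (\int[mu]_(t in A) Psi t)%E); last first.
  by apply: ge0_subset_integral.
apply: (@le_trans _ _ (\int[mu]_(t in A) ((c n)%:E * Phi t))%E); last first.
  apply: ge0_le_integral => //.
  - by move=> t _; rewrite mule_ge0// lee_fin ltW.
  - exact: measurable_funTS.
  - exact: measurable_funTS.
rewrite ge0_integralZl//; [|exact: measurable_funTS|by rewrite lee_fin ltW].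
rewrite EFinM -muleA; apply: lee_wpmul2l; first by rewrite lee_fin ltW.
(* On both sides the integral in [t] is moved inside, so that for each fixed [v] the one-dimensional
   inequality [H1 v] compares [A] with [[-L, L]]. *)
rewrite (@fubini_tonelli_rect _ _ _ _ _ mu (nu d) _ _ _ _ mcube mfc (fun=> f0 _))//.
rewrite /Phi (@fubini_tonelli_rect _ _ _ _ _ mu (nu d) _ _ _ mA mcube mfc (fun=> f0 _)).
rewrite -ge0_integralZl//; last 3 first.
- apply: measurable_funTS.
  exact: (@measurable_fun_integral_fst _ _ _ _ _ mu _ mfc (fun=> f0 _)).
- by move=> v _; apply: integral_ge0 => t _; exact: f0.
- by rewrite lee_fin ltW.
apply: ge0_le_integral => //.
- move=> v _; apply: mule_ge0; first by rewrite lee_fin ltW.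
  by apply: integral_ge0 => t _; exact: f0.
- apply: measurable_funTS; apply: measurable_funeM.
  exact: (@measurable_fun_integral_fst _ _ _ _ _ mu _ mfc (fun=> f0 _)).
- apply: measurable_funTS.
  exact: (@measurable_fun_integral_fst _ _ _ _ _ mu _ mfc (fun=> f0 _)).
- move=> v _; rewrite /f.
  under eq_integral do rewrite /= exp_poly_line.
  under [leRHS]eq_integral do rewrite /= exp_poly_line.
  exact: H1.
Qed.
End borel_case.

(** * From Borel to Lebesgue measurable sets, and from cubes to bounded sets *)

Section completion.
Context {R : realType} {d : nat}.
Local Notation nu := (@borel_lebesgue_rV R d).
Local Open Scope ereal_scope.

Lemma lebesgue_rV_borelE (A : set 'rV[R]_d) : measurable A -> lebesgue_rV A = nu A.
Proof. by move=> mA; exact: measurable_mu_extE. Qed.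

Lemma borel_lebesgue_measurable (A : set 'rV[R]_d) :
  measurable A -> lebesgue_measurable A.
Proof. exact: caratheodory_measurable_mu_ext. Qed.

(* Cover [Q `\` V] by Borel sets of total measure less than [lebesgue_rV Q] and
   remove them from [Q]. *)
Lemma borel_subset_gt0 (Q V : set 'rV[R]_d) : measurable Q -> nu Q < +oo ->
  lebesgue_measurable V -> V `<=` Q -> 0 < lebesgue_rV V ->
  exists2 B, measurable B & B `<=` V /\ 0 < nu B.
Proof.
move=> mQ Qoo mV VQ V0.
(* The Caratheodory condition for [V], tested on [Q]. *)
have QE : nu Q = lebesgue_rV V + lebesgue_rV (Q `\` V).
  rewrite -lebesgue_rV_borelE// [LHS](mV Q); congr (_ + _).
  by rewrite setIC; congr lebesgue_rV; apply/setIidPl.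
have QVoo : lebesgue_rV (Q `\` V) \is a fin_num.
  rewrite ge0_fin_numE ?outer_measure_ge0// (le_lt_trans _ Qoo)// QE.
  by rewrite leeDr// ltW.
have Voo : lebesgue_rV V \is a fin_num.
  rewrite ge0_fin_numE ?ltW// (le_lt_trans _ Qoo)// QE.
  by rewrite leeDl// outer_measure_ge0.
have fV0 : (0 < fine (lebesgue_rV V))%R by rewrite fine_gt0// V0 -ge0_fin_numE// ltW.
have [_ [/= F [mF QVF] <-]] := lb_ereal_inf_adherent fV0 QVoo.
rewrite fineK// -/(lebesgue_rV _) addeC -QE => FQ.
have mUF : measurable (\bigcup_k F k) by exact: bigcupT_measurable.
exists (Q `\` \bigcup_k F k); first exact: measurableD.
split; first by move=> x [Qx nF]; apply: contrapT => nV; exact/nF/QVF.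
rewrite measureD//; rewrite sube_gt0.
apply: le_lt_trans FQ; apply: (@le_trans _ _ (nu (\bigcup_k F k))).
  apply: le_measure; rewrite ?inE//; exact: measurableI.
by apply: measure_sigma_subadditive.
Qed.

(** The identity is measurable from the Lebesgue to the Borel sigma-algebra and pushes the completed
    measure forward to [nu], so this is a change of variables. *)
Lemma integral_lebesgue_rV_borel (A : set 'rV[R]_d) (f : 'rV[R]_d -> \bar R) :
  measurable A -> measurable_fun [set: 'rV[R]_d] f -> (forall x, 0 <= f x) ->
  \int[@lebesgue_rV R d]_(x in A) f x = \int[nu]_(x in A) f x.
Proof.
move=> mA mf f0.
have mid : measurable_fun [set: lebesgue_rV_type R d] (id : _ -> 'rV[R]_d).
  by move=> _ B mB; rewrite setTI preimage_id; exact: borel_lebesgue_measurable.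
pose mid_mixin := isMeasurableFun.Build _ _ _ _ _ mid.
pose phi : {mfun lebesgue_rV_type R d >-> 'rV[R]_d} :=
  HB.pack (id : lebesgue_rV_type R d -> 'rV[R]_d) mid_mixin.
transitivity (\int[pushforward (@lebesgue_rV R d) phi]_(x in A) f x); last first.
  by apply: eq_measure_integral => B mB _; exact: lebesgue_rV_borelE.
rewrite (ge0_integral_pushforward mid)//; exact: measurable_funTS.
Qed.

Lemma measurable_lebesgue_rV (f : 'rV[R]_d -> \bar R) :
  measurable_fun [set: 'rV[R]_d] f ->
  measurable_fun [set: lebesgue_rV_type R d] f.
Proof.
move=> mf _ B mB; apply: borel_lebesgue_measurable.
exact: mf.
Qed.

Lemma bounded_sub_cube (A : set 'rV[R]_d) : bounded_set A ->
  exists L : R, (0 <= L)%R /\ A `<=` cube d L.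
Proof.
(* [bounded_set] bounds the norm by every number strictly above [M], hence the added 1. The norm on
   row vectors is the maximum of the coordinates. *)
move=> [M [Mreal HM]]; exists (`|M| + 1)%R; split; first by rewrite addr_ge0.
move=> x Ax i; rewrite -ler_norml.
apply: (@le_trans _ _ `|x|%R); last first.
  by apply: HM => //; rewrite ltr_pwDr// ler_norm.
rewrite [leRHS]/Num.norm /= mx_normrE; apply/bigmax_geP; right => /=.
by exists (ord0, i).
Qed.

Lemma cube_finite (L : R) : (0 <= L)%R -> nu (cube d L) < +oo.
Proof.
move=> L0; rewrite -lebesgue_rV_borelE; last exact: measurable_cube.
rewrite (_ : cube d L = [set x | forall i, (const_mx (- L) : 'rV[R]_d) ord0 i <=
    x ord0 i <= (const_mx L : 'rV[R]_d) ord0 i]%R).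
  by rewrite lebesgue_rV_box ?ltry// => i; rewrite !mxE; lra.
by apply/seteqP; split => x H i; have := H i; rewrite !mxE.
Qed.

End completion.

Theorem lemma3p2 (R : realType) (d : nat) (Omega V : set 'rV[R]_d)
    (bOmega : bounded_set Omega)
    (mOmega : lebesgue_measurable Omega)
    (Omega_gt0 : (0 < lebesgue_rV Omega)%E)
    (VOmega : V `<=` Omega)
    (mV : lebesgue_measurable V)
    (V_gt0 : (0 < lebesgue_rV V)%E)
    (N : nat) :
  exists gamma : R, 0 < gamma /\
    forall (M : nat) (a : 'I_M -> R[i]) (xi : 'I_M -> 'rV[R]_d), (M <= N)%N ->
      (gamma%:E * L2norm Omega (exp_poly a xi) ^+ 2
         <= L2norm V (exp_poly a xi) ^+ 2)%E.
Proof.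
have [L [L0 OL]] := bounded_sub_cube _ bOmega.
have mQ := @measurable_cube R d L.
have [B mB [BV B0]] := borel_subset_gt0 _ _ mQ (cube_finite _ L0) mV
  (subset_trans VOmega OL) V_gt0.
(* [N.+1] is positive even for [N = 0], and [M <= N] still gives [M <= N.+1]. *)
have [g g0 H] := borel_exp_poly_bound N.+1 L d B (ltn0Sn N) mB B0.
exists g; split => // M a xi MN.
rewrite !L2norm_sqr; under eq_integral do rewrite sqcE.
under [leRHS]eq_integral do rewrite sqcE.
have mf := measurable_sqc_exp_poly d M a xi.
have mfl := measurable_lebesgue_rV _ mf.
have f0 x : (0 <= (sqc (exp_poly a xi x))%:E)%E by rewrite lee_fin.
(* The integrand is nonnegative, so [Omega] may be enlarged to the cube and [V] shrunk to [B]. *)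
apply: (@le_trans _ _ (g%:E * \int[borel_lebesgue_rV d]_(x in cube d L)
    (sqc (exp_poly a xi x))%:E)%E).
  apply: lee_wpmul2l; first by rewrite lee_fin ltW.
  rewrite -integral_lebesgue_rV_borel//.
  apply: ge0_subset_integral => //; first exact: borel_lebesgue_measurable.
  exact: measurable_funTS.
apply: (le_trans (H M a xi (leqW MN))).
rewrite -integral_lebesgue_rV_borel//.
apply: ge0_subset_integral => //; first exact: borel_lebesgue_measurable.
exact: measurable_funTS.
Qed.
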